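(* There is $\nu_0\le 2$ such that the following holds for every real $\nu\ge\nu_0$. Let $(n,m)\in\{(3,0),(2,1),(1,2),(0,3)\}$ and let $\alpha\in\mathbb R$, $\beta\ge0$, $\gamma\ge0$ be such that the first $n$ terms of the expansion of $B(\alpha,\beta,\gamma,x)$ as $x\to0^+$ coincide with those of $K_{\nu+1}(x)/K_\nu(x)$ and the first $m$ terms of the expansion of $B(\alpha,\beta,\gamma,x)$ as $x\to+\infty$ coincide with those of $K_{\nu+1}(x)/K_\nu(x)$ (three terms in total). Then $B(\alpha,\beta,\gamma,x)$ is a bound for $K_{\nu+1}(x)/K_\nu(x)$ for all $x>0$, i.e. either $K_{\nu+1}(x)/K_\nu(x)\le B(\alpha,\beta,\gamma,x)$ for all $x>0$ or $K_{\nu+1}(x)/K_\nu(x)\ge B(\alpha,\beta,\gamma,x)$ for all $x>0$.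
   Context: $K_\nu$ denotes the modified Bessel function of the second kind of real order $\nu$, and $B(\alpha,\beta,\gamma,x)=\dfrac{\alpha+\sqrt{\beta^2+\gamma^2x^2}}{x}$. The successive terms of the expansion at $0^+$ are those in $x^{-1},x,x^3$, and at $+\infty$ those in $x^{0},x^{-1},x^{-2}$ (a term may have zero coefficient). Precisely, ''the first $n$ terms at $0^+$ coincide'' means that the difference of the two functions is $o(x^{2n-3})$ as $x\to0^+$ (no condition if $n=0$), and ''the first $m$ terms at $+\infty$ coincide'' means that the difference is $o(x^{-(m-1)})$ as $x\to+\infty$ (no condition if $m=0$). *)

(* Defs.v *)
From mathcomp Require Export all_boot all_order all_algebra.
From mathcomp Require Export all_classical all_reals all_analysis.
Export Order.TTheory GRing.Theory Num.Theory.
Export numFieldNormedType.Exports.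

Set Implicit Arguments.
Unset Strict Implicit.
Unset Printing Implicit Defensive.

Local Open Scope classical_set_scope.
Local Open Scope ring_scope.

(* The Landau notation needs a packed filter, which the library does not provide
   for +oo. *)
Canonical pinfty_nbhs_filter_on (R : numFieldType) :=
  FilterType (pinfty_nbhs R) _.

Definition cosh {R : realType} (t : R) : R := (expR t + expR (- t)) / 2.

(* K_nu(x) = int_0^oo exp(- x cosh t) cosh(nu t) dt, valid for every real order
   nu when x > 0. The value at x <= 0 is junk, since the integral diverges
   there. *)
Definition besselK {R : realType} (nu x : R) : R :=
  \int[@lebesgue_measure R]_(t in `[0%R, +oo[)
    (expR (- (x * cosh t)) * cosh (nu * t)).

Definition K_ratio {R : realType} (nu x : R) : R :=
  besselK (nu + 1) x / besselK nu x.

Definition Bfun {R : realType} (alpha beta gamma x : R) : R :=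
  (alpha + Num.sqrt (beta ^+ 2 + gamma ^+ 2 * x ^+ 2)) / x.

(* The terms at 0^+ are those in x^-1, x, x^3, so the n-th one has exponent
   2n - 3 and the first n coincide when f - g = o(x^(2n-3)). *)
Definition coincide_at_0 {R : realType} (n : nat) (f g : R -> R) : Prop :=
  (0 < n)%N ->
  (fun x : R => f x - g x : R^o) =o_ (0^'+) (fun x : R => x ^ (2 * n%:Z - 3) : R^o).

(* The terms at +oo are those in x^0, x^-1, x^-2, so the m-th one has exponent
   -(m-1) and the first m coincide when f - g = o(x^-(m-1)). *)
Definition coincide_at_infty {R : realType} (m : nat) (f g : R -> R) : Prop :=
  (0 < m)%N ->
  (fun x : R => f x - g x : R^o) =o_ (+oo_R) (fun x : R => x ^ (- (m%:Z - 1)) : R^o).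

(* Main.v *)
Require Import Defs.
From mathcomp Require Import all_boot all_order all_algebra.
From mathcomp Require Import all_classical all_reals all_analysis.
From mathcomp Require Import ring lra zify measurable_realfun.
Local Open Scope classical_set_scope.
Local Open Scope ring_scope.
Set Implicit Arguments.
Unset Strict Implicit.
Unset Printing Implicit Defensive.

(** The function phi(x) = x K_(nu+1)(x) / K_nu(x) ([xratio]) solves the Riccati
equation x phi' = phi^2 - 2 nu phi - x^2 and exceeds 2 nu ([xratio_riccati],
[xratio_gt]). Let b(x) = alpha + s with s = sqrt(beta^2 + gamma^2 x^2)
([branch]), and let b^2 - 2 nu b - x^2 - x b' be its residual. Then w = phi - b
satisfies x w' = w (phi + b - 2 nu) + residual.

A residual of constant sign decides which of phi and b is larger, without any
information at the end points. If the residual is nonnegative and w were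
positive somewhere, then x w' >= w^2 from there on, and w would blow up at a
finite abscissa ([riccati_supersolution]). If it is nonpositive and w were
negative somewhere, then -w would grow at least like x^2, although -w <= b is
O(x) ([riccati_subsolution]).

Each choice of (n, m) forces conditions on (alpha, beta, gamma) under which the
residual has a constant sign:
 - (2,1): alpha = nu + 1, beta = nu - 1, gamma = 1, residual
   (s - beta)^2 / s >= 0, hence an upper bound;
 - (1,2): alpha = nu + 1/2, beta = nu - 1/2, gamma = 1, residual
   - beta + beta^2 / s <= 0, hence a lower bound;
 - (0,3): alpha = nu + 1/2, gamma = 1, beta^2 >= nu^2 - 1/4, residual
   beta^2 - (nu^2 - 1/4) + beta^2 / s >= 0, hence an upper bound;
 - (3,0): alpha = nu + 2, beta = nu - 2, gamma^2 = (nu - 2) / (nu - 1), residual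
   - (s - beta)^3 / (beta s) <= 0, hence a lower bound.

The parameters are read off from limits of phi. At 0, the recurrence
phi_nu = 2 nu + x^2 / phi_(nu-1) ([xratio_recurrence]) turns the single limit
phi_nu -> 2 nu, valid for nu >= 0 ([riccati_cvg0]), into the first three
coefficients. For nu = 2 the limit phi_0 -> 0 shows that three terms cannot
coincide, as beta = nu - 2 is then incompatible with beta > 0; the logarithmic
term of K_2 thus needs no separate treatment. At infinity the coefficients come
from squeezing phi between the bounds (1,2) and (0,3); for the third one, a
lower bound valid only near infinity excludes beta^2 < nu^2 - 1/4.

The facts used on K_nu are its positivity, its derivative
- (K_(nu+1) + K_(nu-1)) / 2 and the recurrence
x (K_(nu+1) - K_(nu-1)) = 2 nu K_nu, all obtained from the integral
representation: differentiation under the integral sign gives the second, and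
the third says that the integral over [0, +oo) of the derivative of
exp(- x cosh t) sinh(nu t) is zero. *)

(** * Hyperbolic functions *)

Section hyperbolic.
Variable R : realType.
Implicit Types t u : R.

Definition sinh t : R := (expR t - expR (- t)) / 2.

Lemma cosh_gt0 t : 0 < cosh t.
Proof. by rewrite /cosh divr_gt0 ?addr_gt0 ?expR_gt0. Qed.

Lemma sinh_le_cosh t : `|sinh t| <= cosh t.
Proof.
rewrite /sinh /cosh ler_norml.
have := expR_gt0 t; have := expR_gt0 (- t); lra.
Qed.

Lemma mulcoshcosh t u : cosh t * cosh u = (cosh (t + u) + cosh (t - u)) / 2.
Proof.
rewrite /cosh !opprD !opprK !expRD; by field.
Qed.

Lemma mulsinhsinh t u : sinh t * sinh u = (cosh (t + u) - cosh (t - u)) / 2.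
Proof.
rewrite /cosh /sinh !opprD !opprK !expRD; by field.
Qed.

Lemma cosh_le_expR t : cosh t <= expR `|t|.
Proof.
have h u : expR u <= expR `|u| by rewrite ler_expR ler_norm.
rewrite /cosh; have := h t; have := h (- t); rewrite normrN; lra.
Qed.

Lemma cosh_ge_sqr t : 0 <= t -> t ^+ 2 / 8 <= cosh t.
Proof.
move=> t0; have := expR_ge1Dxn 1 t0; have := expR_gt0 (- t).
rewrite /cosh (_ : 2`!%:R = 2)//.
have := sqr_ge0 t; lra.
Qed.

Global Instance is_derive_cosh t : is_derive t 1 (@cosh R) (sinh t).
Proof.
rewrite /cosh /sinh; apply: is_derive_eq; rewrite /GRing.scale/=; ring.
Qed.

Global Instance is_derive_sinh t : is_derive t 1 sinh (cosh t).
Proof.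
rewrite /cosh /sinh; apply: is_derive_eq; rewrite /GRing.scale/=; ring.
Qed.

End hyperbolic.

(** * The integral representation of the Bessel function *)

Section bessel.
Variable R : realType.
Implicit Types mu nu x t : R.
Notation leb := (@lebesgue_measure R).

Definition bessel_integrand mu x t : R := expR (- (x * cosh t)) * cosh (mu * t).

Lemma integrand_gt0 mu x t : 0 < bessel_integrand mu x t.
Proof. by rewrite mulr_gt0 ?expR_gt0 ?cosh_gt0. Qed.

(** The exponent - x cosh t + |mu| t + t is at most a concave quadratic in t,
since cosh t >= t^2 / 8; the constant C is the exponential of its maximum. *)
Lemma integrand_le_expR mu x : 0 < x ->
  exists2 C : R, 0 < C &
    forall t, 0 <= t -> bessel_integrand mu x t <= C * expR (- t).
Proof.
move=> x0; exists (expR (2 * (`|mu| + 1) ^+ 2 / x)); first exact: expR_gt0.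
move=> t t0; rewrite /bessel_integrand.
apply: (@le_trans _ _ (expR (- (x * cosh t)) * expR (`|mu| * t))).
  rewrite ler_wpM2l ?expR_ge0//.
  by rewrite (le_trans (cosh_le_expR _))// normrM (ger0_norm t0).
rewrite -!expRD ler_expR.
have h : x * (t ^+ 2 / 8) <= x * cosh t by rewrite ler_wpM2l ?cosh_ge_sqr// ltW.
set c := `|mu| + 1.
rewrite -subr_ge0 (_ : _ - _ = (x * cosh t - x * (t ^+ 2 / 8)) +
   (x / 8) * (t - 4 * c / x) ^+ 2); last by rewrite /c; field; rewrite gt_eqF.
by rewrite addr_ge0 ?subr_ge0// mulr_ge0 ?sqr_ge0// divr_ge0// ltW.
Qed.

Lemma is_derive_integrand_x mu x t :
  is_derive x 1 (fun y => bessel_integrand mu y t)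
    (- (cosh t * bessel_integrand mu x t)).
Proof.
rewrite /bessel_integrand; apply: is_derive_eq; rewrite /GRing.scale/=; ring.
Qed.

Lemma continuous_integrand mu x : continuous (bessel_integrand mu x).
Proof.
move=> t; apply: differentiable_continuous; apply/derivable1_diffP.
by rewrite /bessel_integrand; apply: ex_derive.
Qed.

Lemma integrable_expRN :
  leb.-integrable `[0, +oo[ (EFin \o (fun t => expR (- t))).
Proof.
have := @integrable_exponential_pdf R 1 ltr01.
move/(@integrableS _ _ _ leb _ `[0, +oo[%classic) => /(_ _ _ _).
move=> /(_ measurableT) h.
apply: eq_integrable (h _ _) => //.
move=> t; rewrite inE/= in_itv/= andbT => t0.
by rewrite exponential_pdfE// mul1r mulN1r.
Qed.

Lemma integrable_dominated (f : R -> R) C : continuous f ->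
  (forall t, 0 <= t -> `|f t| <= C * expR (- t)) ->
  leb.-integrable `[0, +oo[ (EFin \o f).
Proof.
move=> cf fC.
have ig : leb.-integrable `[0, +oo[ (EFin \o (fun t => C * expR (- t))).
  rewrite (_ : _ \o _ = (fun t => C%:E * (EFin \o (fun t => expR (- t))) t)%E).
    by apply: integrableZl => //; exact: integrable_expRN.
  by apply/funext => t /=; rewrite EFinM.
apply: (le_integrable _ _ _ ig) => //.
- apply/measurable_EFinP; apply: measurable_funTS.
  exact: continuous_measurable_fun.
- move=> t /=; rewrite in_itv/= andbT => t0; rewrite lee_fin.
  exact: le_trans (fC t t0) (ler_norm _).
Qed.

Lemma integrable_integrand mu x : 0 < x ->
  leb.-integrable `[0, +oo[ (EFin \o bessel_integrand mu x).
Proof.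
move=> x0; have [C C0 h] := integrand_le_expR mu x0.
apply: (@integrable_dominated _ C); first exact: continuous_integrand.
by move=> t t0; rewrite ger0_norm ?h// ltW// integrand_gt0.
Qed.

Lemma besselK_gt0 mu x : 0 < x -> 0 < besselK mu x.
Proof.
move=> x0; pose m := expR (- (x * expR 1)).
have cosh_ge1 (t : R) : 1 <= cosh t.
  by rewrite /cosh; have := expR_ge1Dx t; have := expR_ge1Dx (- t); lra.
have km t : 0 <= t -> t <= 1 -> m <= bessel_integrand mu x t.
  move=> t0 t1; rewrite -[m]mulr1 ler_pM ?expR_ge0 ?ler01//.
  rewrite ler_expR lerN2 ler_pM2l// (le_trans (cosh_le_expR t))//.
  by rewrite ler_expR ger0_norm.
have i01 : leb.-integrable `[0, 1] (EFin \o bessel_integrand mu x).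
  apply: integrableS (integrable_integrand mu x0) => //.
  by apply: subset_itvl.
have im : leb.-integrable `[0, 1] (EFin \o (fun=> m)).
  apply: continuous_compact_integrable => //; first exact: segment_compact.
  by apply: continuous_subspaceT => t; exact: cvg_cst.
have : m <= \int[leb]_(t in `[0, 1]) bessel_integrand mu x t.
  have -> : m = \int[leb]_(t in `[0, 1]) m.
    rewrite Rintegral_cst//= [lebesgue_measure _]lebesgue_measure_itv/= lte01.
    by rewrite -EFinB subr0 mulr1.
  apply: le_Rintegral => // t /=; rewrite in_itv/= => /andP[t0 t1].
  exact: km.
move=> mk; apply: (lt_le_trans (expR_gt0 _)); apply: (le_trans mk).
rewrite /besselK /Rintegral fine_le//.
- exact: integrable_fin_num.
- exact: (integrable_fin_num _ (integrable_integrand mu x0)).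
apply: ge0_subset_integral => //=.
- have /integrableP[] := integrable_integrand mu x0; by [].
- by move=> t _; rewrite lee_fin ltW// integrand_gt0.
- exact: subset_itvl.
Qed.

(** The fundamental theorem on a half-line is available for integrands of
constant sign. Adding C exp(- t), whose own integral is known, makes the
dominated integrand nonnegative. *)
Lemma Rintegral_dominated_FTC2y (f F : R -> R) C : continuous f ->
  (forall t, is_derive t 1 F (f t)) ->
  (forall t, 0 <= t -> `|f t| <= C * expR (- t)) ->
  F t @[t --> +oo] --> 0 ->
  \int[leb]_(t in `[0, +oo[) f t = - F 0.
Proof.
move=> cf dF fC F0.
have FTC (g G : R -> R) : continuous g -> (forall t, 0 <= t -> 0 <= g t) ->
    (forall t, is_derive t 1 G (g t)) -> G t @[t --> +oo] --> 0 ->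
    \int[leb]_(t in `[0, +oo[) g t = - G 0.
  move=> cg g0 dG G0; rewrite -[RHS]add0r.
  apply: Rintegral_ge0_continuous_FTC2y => //.
  - exact: continuous_subspaceT.
  - apply: cvg_at_right_filter; apply: differentiable_continuous.
    by apply/derivable1_diffP; have [] := dG 0.
  - by move=> t _; rewrite derive1E; have [] := dG t.
have ce : continuous (fun t : R => C * expR (- t)).
  move=> t; apply: differentiable_continuous; apply/derivable1_diffP.
  exact: ex_derive.
have de (t : R) :
    is_derive t 1 (fun t : R => - (C * expR (- t))) (C * expR (- t)).
  by apply: is_derive_eq; rewrite /GRing.scale/=; ring.
have e0 : - (C * expR (- t)) @[t --> +oo] --> (0 : R).
  rewrite -oppr0 -(mulr0 C); apply: cvgN; apply: cvgM; first exact: cvg_cst.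
  exact: cvgr_expR.
have ie : leb.-integrable `[0, +oo[ (EFin \o (fun t : R => C * expR (- t))).
  apply: (@integrable_dominated _ C) => // t t0.
  have := fC t t0; have := normr_ge0 (f t).
  by move=> h1 h2; rewrite ger0_norm// (le_trans h1).
have if_ : leb.-integrable `[0, +oo[ (EFin \o f).
  exact: integrable_dominated fC.
have Ie : \int[leb]_(t in `[0, +oo[) (C * expR (- t)) = C.
  rewrite (FTC _ _ ce _ de e0) ?oppr0 ?expR0 ?mulr1 ?opprK// => t t0.
  exact: le_trans (fC t t0).
have : \int[leb]_(t in `[0, +oo[) (f t + C * expR (- t)) = - (F 0 - C).
  rewrite -[X in _ - X]mulr1 -expR0 -[X in expR X]oppr0.
  have cfe : continuous (fun t : R => f t + C * expR (- t)).
    by move=> t; apply: cvgD; [exact: cf|exact: ce].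
  apply: (FTC _ (fun t => F t - C * expR (- t)) cfe).
  - move=> t t0; have := fC t t0; rewrite ler_norml => /andP[+ _]; lra.
  - by rewrite -(addr0 0); apply: cvgD.
by rewrite RintegralD// Ie; lra.
Qed.

(** Integrate the derivative of exp(- x cosh t) sinh(mu t), which vanishes at 0
and at +oo; the product sinh t sinh(mu t) linearizes to the two neighbouring
orders. *)
Lemma besselK_recurrence mu x : 0 < x ->
  x * (besselK (mu + 1) x - besselK (mu - 1) x) = 2 * mu * besselK mu x.
Proof.
move=> x0.
pose f t := mu * bessel_integrand mu x t -
  x / 2 * (bessel_integrand (mu + 1) x t - bessel_integrand (mu - 1) x t).
pose F t := expR (- (x * cosh t)) * sinh (mu * t).
have dF t : is_derive t 1 F (f t).
  rewrite /F; apply: is_derive_eq; rewrite /GRing.scale/= /f /bessel_integrand.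
  have := mulsinhsinh (mu * t) t.
  rewrite (_ : mu * t + t = (mu + 1) * t); last by ring.
  rewrite (_ : mu * t - t = (mu - 1) * t); last by ring.
  move=> h; transitivity (expR (- (x * cosh t)) *
    (mu * cosh (mu * t) - x * (sinh (mu * t) * sinh t))); first by ring.
  by rewrite h; field.
have [C0 C0_gt0 h0] := integrand_le_expR mu x0.
have [C1 C1_gt0 h1] := integrand_le_expR (mu + 1) x0.
have [C2 C2_gt0 h2] := integrand_le_expR (mu - 1) x0.
have i0 := integrable_integrand mu x0.
have i1 := integrable_integrand (mu + 1) x0.
have i2 := integrable_integrand (mu - 1) x0.
have cf : continuous f.
  move=> t; apply: cvgB; apply: cvgM; first exact: cvg_cst.
  - exact: continuous_integrand.
  - exact: cvg_cst.
  - by apply: cvgB; exact: continuous_integrand.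
have fC t : 0 <= t -> `|f t| <= (`|mu| * C0 + x / 2 * (C1 + C2)) * expR (- t).
  move=> t0; rewrite /f (le_trans (ler_normB _ _))// mulrDl lerD//.
    rewrite normrM -mulrA ler_wpM2l// ger0_norm ?h0//.
    by rewrite ltW// integrand_gt0.
  rewrite normrM gtr0_norm ?divr_gt0// -[leRHS]mulrA ler_pM2l ?divr_gt0//.
  have := h1 _ t0; have := h2 _ t0.
  have := integrand_gt0 (mu + 1) x t; have := integrand_gt0 (mu - 1) x t.
  by rewrite ler_norml mulrDl; lra.
have F0 : F t @[t --> +oo] --> 0.
  have e0 : C0 * expR (- t) @[t --> +oo] --> (0 : R).
    by rewrite -(mulr0 C0); apply: cvgM; [exact: cvg_cst|exact: cvgr_expR].
  apply: norm_cvg0; apply: squeeze_cvgr e0; last exact: cvg_cst.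
  near=> t; rewrite normr_ge0/= /F normrM ger0_norm ?expR_ge0//.
  apply: le_trans (h0 t _); last by near: t; exact: nbhs_pinfty_ge.
  by rewrite ler_wpM2l ?expR_ge0 ?sinh_le_cosh.
have := Rintegral_dominated_FTC2y cf dF fC F0.
have i12 : leb.-integrable `[0, +oo[ (EFin \o (fun t : R =>
    bessel_integrand (mu + 1) x t - bessel_integrand (mu - 1) x t)).
  exact: (integrableB _ i1 i2).
have -> : - F 0 = 0.
  by rewrite /F mulr0 /sinh oppr0 subrr mul0r mulr0 oppr0.
rewrite /f RintegralB//=.
- rewrite !RintegralZl// RintegralB// -!/(besselK _ x); lra.
- exact: (integrableZl _ mu i0).
- exact: (integrableZl _ (x / 2) i12).
Unshelve. all: by end_near. Qed.

(** The integrand decreases in x, so the x-derivative on the interval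
]x / 2, 2 x[ is dominated by its value at x / 2. *)
Lemma is_derive_besselK mu x : 0 < x ->
  is_derive x 1 (besselK mu)
    (- ((besselK (mu + 1) x + besselK (mu - 1) x) / 2)).
Proof.
move=> x0.
have ch y t : cosh t * bessel_integrand mu y t =
    (bessel_integrand (mu + 1) y t + bessel_integrand (mu - 1) y t) / 2.
  have := mulcoshcosh (mu * t) t; rewrite /bessel_integrand.
  rewrite (_ : mu * t + t = (mu + 1) * t); last by ring.
  rewrite (_ : mu * t - t = (mu - 1) * t); last by ring.
  move=> h; rewrite mulrCA (mulrC (cosh t)) h; by field.
have x20 : 0 < x / 2 by rewrite divr_gt0.
pose G t := cosh t * bessel_integrand mu (x / 2) t.
have G0 t : 0 <= G t by rewrite mulr_ge0// ltW ?cosh_gt0 ?integrand_gt0.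
have isum y : 0 < y -> leb.-integrable `[0, +oo[ (EFin \o (fun t : R =>
    bessel_integrand (mu + 1) y t + bessel_integrand (mu - 1) y t)).
  move=> y0.
  exact: (integrableD _ (integrable_integrand (mu + 1) y0)
                        (integrable_integrand (mu - 1) y0)).
have iG : leb.-integrable `[0, +oo[ (EFin \o G).
  rewrite (_ : G = fun t => 2^-1 * (bessel_integrand (mu + 1) (x / 2) t +
      bessel_integrand (mu - 1) (x / 2) t)).
    exact: (integrableZl _ 2^-1 (isum _ x20)).
  by apply/funext => t; rewrite /G ch mulrC.
pose I := `]x / 2, 2 * x[%classic : set R.
have Ix : I x by rewrite /I/= in_itv/=; apply/andP; split; lra.
have I0 y : I y -> x / 2 < y by rewrite /I/= in_itv/= => /andP[].
have d1 y t : partial1of2 (bessel_integrand mu) y t =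
    - (cosh t * bessel_integrand mu y t).
  by rewrite partial1of2E; have [] := is_derive_integrand_x mu y t.
have intf y : I y -> leb.-integrable `[0, +oo[ (EFin \o bessel_integrand mu y).
  by move=> /I0 y0; apply: integrable_integrand; exact: lt_trans y0.
have derf (y : R) (t : measurableTypeR R) : I y -> `[0, +oo[%classic t ->
    derivable (fun z => bessel_integrand mu z t) y 1.
  by move=> _ _; have [] := is_derive_integrand_x mu y t.
have Gub y (t : measurableTypeR R) : I y -> `[0, +oo[%classic t ->
    `|partial1of2 (bessel_integrand mu) y t| <= G t.
  move=> /I0 y0 _; rewrite d1 normrN /G ger0_norm; last first.
    by rewrite mulr_ge0// ltW ?cosh_gt0 ?integrand_gt0.
  rewrite ler_pM2l ?cosh_gt0// ler_pM2r ?cosh_gt0// ler_expR lerN2.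
  by rewrite ler_pM2r ?cosh_gt0// ltW.
have mB : measurable (`[0, +oo[%classic : set (measurableTypeR R)) by [].
apply: DeriveDef.
  exact: (derivable_under_integral mB Ix intf derf G0 iG Gub).
rewrite -derive1E (differentiation_under_integral mB Ix intf derf G0 iG Gub).
under eq_Rintegral do rewrite d1 ch mulrC -mulNr.
rewrite RintegralZl ?isum// RintegralD ?integrable_integrand//.
by rewrite -!/(besselK _ _); ring.
Qed.

End bessel.

(** * Differential inequalities *)

Section differential_inequalities.
Variable R : realType.
Implicit Types (f df : R -> R) (a b c x : R).

Lemma derive_ge0_le f df a b : a <= b ->
  (forall x, a <= x <= b -> is_derive x 1 f (df x)) ->
  (forall x, a < x < b -> 0 <= df x) -> f a <= f b.
Proof.
rewrite le_eqVlt => /predU1P[->//|ab] fdf df0.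
have [||] := @MVT _ f df _ _ ab.
- by move=> x; rewrite in_itv/= => /andP[ax xb]; apply: fdf; rewrite !ltW.
- by apply: derivable_within_continuous => x; rewrite in_itv/= => /fdf[].
move=> x; rewrite in_itv/= => xab /eqP; rewrite -subr_ge0 => /eqP ->.
by rewrite mulr_ge0 ?df0// subr_ge0 ltW.
Qed.

(** A function that cannot decrease while it is above the level c, and starts
there, never falls below its starting value: otherwise consider the first point
where it reaches a level strictly between c and that value. *)
Lemma derive_barrier f df a b c : a <= b ->
  (forall x, a <= x <= b -> is_derive x 1 f (df x)) ->
  c < f a -> (forall x, a <= x <= b -> c < f x -> 0 <= df x) -> f a <= f b.
Proof.
move=> ab fdf cfa df0; rewrite leNgt; apply/negP => fba.
pose c' := (Num.max c (f b) + f a) / 2.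
have cM : c <= Num.max c (f b) by rewrite le_max lexx.
have fM : f b <= Num.max c (f b) by rewrite le_max lexx orbT.
have Mf : Num.max c (f b) < f a by rewrite gt_max cfa.
have cc' : c < c' by rewrite /c'; lra.
have fbc' : f b <= c' by rewrite /c'; lra.
have c'fa : c' < f a by rewrite /c'; lra.
pose S := [set x | a <= x <= b /\ f x <= c'].
have Sb : S b by split => //; rewrite ab lexx.
have Slb : lbound S a by move=> x [/andP[]].
have hS : has_inf S by split; [exists b | exists a].
set m := inf S.
have am : a <= m by apply: lb_le_inf => //; exists b.
have mb : m <= b by apply: ge_inf => //; exists a.
have before x : a <= x < m -> c' < f x.
  move=> /andP[ax xm]; rewrite ltNge; apply/negP => fx.
  have : m <= x.
    apply: ge_inf; first by exists a.
    by split => //; rewrite ax (le_trans (ltW xm)).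
  by rewrite leNgt xm.
have fm : f m <= c'.
  rewrite leNgt; apply/negP => c'fm.
  have cf : {for m, continuous f}.
    apply: differentiable_continuous; apply/derivable1_diffP.
    by have [] := fdf m (introT andP (conj am mb)).
  have : \forall t \near m, c' < f t by exact: (@cvgr_gt _ _ _ _ _ _ cf).
  move=> [e /= e0 he].
  have [s [/andP[as_ sb] fs] sme] := inf_adherent e0 hS.
  have ms : m <= s by apply: ge_inf; [exists a|split => //; rewrite as_].
  suff /he : ball_ Num.norm m e s by apply/negP; rewrite -leNgt.
  by rewrite /= ler0_norm ?subr_le0// opprB ltrBlDr addrC.
have : f a <= f m.
  apply: (@derive_ge0_le f df) => //.
    by move=> x /andP[ax xm]; apply: fdf; rewrite ax (le_trans xm).
  move=> x /andP[ax xm]; apply: df0; first by rewrite !ltW// (lt_le_trans xm).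
  by apply: (lt_trans cc'); apply: before; rewrite ltW.
lra.
Qed.

(** Solutions of x f' >= k f^2 blow up: - 1 / f - k ln x is nondecreasing, so
the length of the interval on a logarithmic scale is bounded by the initial
value. *)
Lemma quadratic_growth_bound f df a b k : 0 < a -> a <= b ->
  (forall x, a <= x <= b -> is_derive x 1 f (df x)) ->
  (forall x, a <= x <= b -> 0 < f x) ->
  (forall x, a <= x <= b -> k * f x ^+ 2 <= x * df x) ->
  k * (ln b - ln a) <= (f a)^-1.
Proof.
move=> a0 ab fdf f0 kf.
have : - (f a)^-1 - k * ln a <= - (f b)^-1 - k * ln b.
  apply: (@derive_ge0_le (fun x => - (f x)^-1 - k * ln x)
    (fun x => df x / f x ^+ 2 - k / x)) => //.
  - move=> x /[dup] xab /andP[ax xb].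
    have x0 : 0 < x by exact: lt_le_trans ax.
    have dx := fdf x xab; have fx := f0 x xab.
    have d1 := is_deriveV (lt0r_neq0 fx) dx.
    have d2 := is_derive1_ln x0.
    apply: is_derive_eq; rewrite /GRing.scale/=; field.
    by rewrite !gt_eqF.
  - move=> x /andP[ax xb].
    have xab : a <= x <= b by rewrite !ltW.
    have x0 : 0 < x by exact: lt_trans ax.
    have fx := f0 x xab.
    rewrite subr_ge0 ler_pdivrMr// mulrAC ler_pdivlMr ?exprn_gt0//.
    by rewrite (mulrC _ x) kf.
have : 0 < (f b)^-1 by rewrite invr_gt0 f0// ab lexx.
lra.
Qed.

End differential_inequalities.

(** * Sub- and supersolutions of the Riccati equation *)

Section riccati.
Variable R : realType.
Variables (nu : R) (phi : R -> R).
Hypothesis phi_riccati : forall x : R, 0 < x ->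
  is_derive x 1 phi ((phi x ^+ 2 - 2 * nu * phi x - x ^+ 2) / x).

Definition riccati_residual (b db : R -> R) (x : R) : R :=
  b x ^+ 2 - 2 * nu * b x - x ^+ 2 - x * db x.

(** The difference w = phi - b satisfies
x w' = w^2 + 2 w (b - nu) + residual >= w^2 as soon as it is positive, which is
impossible on a whole half-line. *)
Lemma riccati_supersolution (b db : R -> R) (a : R) : 0 < a ->
  (forall x, a <= x -> is_derive x 1 b (db x)) ->
  (forall x, a <= x -> nu <= b x) ->
  (forall x, a <= x -> 0 <= riccati_residual b db x) ->
  forall x, a <= x -> phi x <= b x.
Proof.
move=> a0 bdb nub res0 x0 ax0; rewrite leNgt; apply/negP => bphi.
have x0_gt0 : 0 < x0 by exact: lt_le_trans ax0.
pose w x := phi x - b x.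
pose dw x := (phi x ^+ 2 - 2 * nu * phi x - x ^+ 2) / x - db x.
have w0 : 0 < w x0 by rewrite subr_gt0.
have wdw x : x0 <= x -> is_derive x 1 w (dw x).
  move=> x0x; have dphi := phi_riccati (lt_le_trans x0_gt0 x0x).
  have dbx := bdb x (le_trans ax0 x0x).
  exact: is_deriveB.
have grow x : x0 <= x -> 0 < w x -> 1 * w x ^+ 2 <= x * dw x.
  move=> x0x wx; have x_gt0 : 0 < x by exact: lt_le_trans x0x.
  have ax := le_trans ax0 x0x.
  rewrite -subr_ge0
    (_ : _ - _ = riccati_residual b db x + 2 * w x * (b x - nu)).
    apply: addr_ge0; first exact: res0.
    by apply: mulr_ge0; [rewrite mulr_ge0// ltW|rewrite subr_ge0 nub].
  by rewrite /riccati_residual /dw /w; field; rewrite gt_eqF.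
have wpos x : x0 <= x -> w x0 <= w x.
  move=> x0x; apply: (@derive_barrier _ w dw x0 x 0) => //.
    by move=> y /andP[x0y _]; exact: wdw.
  move=> y /andP[x0y _] wy; have y0 : 0 < y by exact: lt_le_trans x0y.
  rewrite -(pmulr_rge0 _ y0); apply: le_trans (grow y x0y wy).
  by rewrite mul1r sqr_ge0.
(* [y] is chosen so that ln y - ln x0 exceeds the bound 1 / w(x0). *)
pose y := x0 * expR ((w x0)^-1 + 1).
have e1 : 1 <= expR ((w x0)^-1 + 1).
  by rewrite -expR0 ler_expR addr_ge0 ?invr_ge0 ?ltW.
have x0y : x0 <= y by rewrite /y ler_peMr// ltW.
have : 1 * (ln y - ln x0) <= (w x0)^-1.
  apply: (@quadratic_growth_bound _ w dw) => //.
  - by move=> x /andP[x0x _]; exact: wdw.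
  - by move=> x /andP[x0x _]; rewrite (lt_le_trans w0) ?wpos.
  - by move=> x /andP[x0x _]; rewrite grow// (lt_le_trans w0) ?wpos.
rewrite /y lnM ?posrE ?expR_gt0// expRK; lra.
Qed.

Hypothesis phi_ge : forall x : R, 0 < x -> 2 * nu <= phi x.

(** The difference v = b - phi satisfies
x v' = v (b + phi - 2 nu) - residual >= 2 v as soon as it is positive, since
phi >= 2 nu and b >= 2. Then v / x^2 is nondecreasing, against v <= b <= C x. *)
Lemma riccati_subsolution (b db : R -> R) (a C : R) : 0 <= nu -> 0 < a ->
  (forall x, a <= x -> is_derive x 1 b (db x)) ->
  (forall x, a <= x -> 2 <= b x <= C * x) ->
  (forall x, a <= x -> riccati_residual b db x <= 0) ->
  forall x, a <= x -> b x <= phi x.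
Proof.
move=> nu0 a0 bdb bC res0 x0 ax0; rewrite leNgt; apply/negP => bphi.
have x0_gt0 : 0 < x0 by exact: lt_le_trans ax0.
pose v x := b x - phi x.
pose dv x := db x - (phi x ^+ 2 - 2 * nu * phi x - x ^+ 2) / x.
pose f x := v x * x^-1 ^+ 2.
pose df x := dv x * x^-1 ^+ 2 - 2 * v x * x^-1 ^+ 3.
have f0 : 0 < f x0 by rewrite mulr_gt0 ?subr_gt0// exprn_gt0 ?invr_gt0.
have fdf x : x0 <= x -> is_derive x 1 f (df x).
  move=> x0x; have x_gt0 := lt_le_trans x0_gt0 x0x.
  have dphi := phi_riccati x_gt0.
  have dbx := bdb x (le_trans ax0 x0x).
  have dV := is_deriveV (lt0r_neq0 x_gt0) (is_derive_id x 1).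
  rewrite /f /v; apply: is_derive_eq; rewrite /GRing.scale/= /df /dv /v.
  by field; rewrite gt_eqF.
have fpos x : x0 <= x -> f x0 <= f x.
  move=> x0x; apply: (@derive_barrier _ f df x0 x 0) => //.
    by move=> y /andP[x0y _]; exact: fdf.
  move=> y /andP[x0y _] fy; have y0 : 0 < y by exact: lt_le_trans x0y.
  have ay := le_trans ax0 x0y.
  have vy : 0 < v y by move: fy; rewrite /f pmulr_lgt0 ?exprn_gt0 ?invr_gt0.
  have yV : 0 < y^-1 by rewrite invr_gt0.
  rewrite (_ : df y = y^-1 ^+ 3 * (- riccati_residual b db y +
      v y * (b y - 2) + v y * (phi y - 2 * nu))).
    have /andP[b2 _] := bC y ay.
    rewrite mulr_ge0 ?exprn_ge0 ?(ltW yV)// !addr_ge0 ?oppr_ge0 ?res0//.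
      by rewrite mulr_ge0 ?(ltW vy)// subr_ge0.
    by rewrite mulr_ge0 ?(ltW vy)// subr_ge0 phi_ge.
  by rewrite /df /dv /v /riccati_residual; field; rewrite gt_eqF.
pose x := Num.max x0 (C / f x0 + 1).
have x0x : x0 <= x by rewrite le_max lexx.
have x_gt0 := lt_le_trans x0_gt0 x0x.
have Cx : C / f x0 + 1 <= x by rewrite le_max lexx orbT.
have ax := le_trans ax0 x0x.
have : f x0 * x <= C.
  rewrite -(ler_pM2r x_gt0) -mulrA -expr2.
  have /andP[_ /(le_trans _)] := bC x ax; apply.
  have := fpos x x0x; rewrite {2}/f exprVn ler_pdivlMr ?exprn_gt0//.
  move=> /le_trans; apply.
  by rewrite /v gerBl (le_trans _ (phi_ge x_gt0))// mulr_ge0.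
move: Cx; rewrite -(ler_pM2l f0) mulrDr mulrCA mulfV ?gt_eqF// !mulr1; lra.
Qed.

(** With w = phi - 2 nu >= 0 one has x w' >= w^2 - x^2. If w(x1) >= e at a point
x1 < e / 2, then w stays above e up to e / 2, where x w' >= 3/4 w^2; the blow-up
estimate bounds x1 away from 0. *)
Lemma riccati_cvg0 : 0 <= nu -> phi x @[x --> 0^'+] --> 2 * nu.
Proof.
move=> nu0; apply/cvgrPdist_lt => e e0.
pose h := e / 2; have h0 : 0 < h by rewrite divr_gt0.
pose w x := phi x - 2 * nu.
pose dw x := (phi x ^+ 2 - 2 * nu * phi x - x ^+ 2) / x.
have wdw (x : R) : 0 < x -> is_derive x 1 w (dw x).
  move=> x0; have dphi := phi_riccati x0.
  by rewrite /w; apply: is_derive_eq; rewrite subr0.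
have w_ge0 x : 0 < x -> 0 <= w x by move=> x0; rewrite subr_ge0 phi_ge.
have grow x : 0 < x -> w x ^+ 2 - x ^+ 2 <= x * dw x.
  move=> x0; rewrite -subr_ge0 (_ : _ - _ = 2 * nu * w x).
    by rewrite !mulr_ge0// w_ge0.
  by rewrite /dw /w; field; rewrite gt_eqF.
near=> x1.
have x1_gt0 : 0 < x1 by near: x1; exact: nbhs_right_gt.
(* At such x1 the logarithmic length ln h - ln x1 exceeds 2 / e, whereas the
   blow-up estimate below allows at most 4 / (3 e). *)
have x1_lt : x1 < h * expR (- (2 / e)).
  by near: x1; apply: nbhs_right_lt; rewrite mulr_gt0 ?expR_gt0.
rewrite distrC ger0_norm ?w_ge0// ltNge; apply/negP => ew.
have x1h : x1 <= h.
  apply: (le_trans (ltW x1_lt)); rewrite ler_piMr ?(ltW h0)//.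
  by rewrite expR_le1 oppr_le0 divr_ge0// ltW.
have he : h < e by rewrite /h; lra.
have we y : x1 <= y <= h -> e <= w y.
  move=> /andP[x1y yh]; apply: (le_trans ew).
  apply: (@derive_barrier _ w dw x1 y h) => //; last 2 first.
  - by apply: lt_le_trans ew.
  - move=> z /andP[x1z zy] hw; have z0 := lt_le_trans x1_gt0 x1z.
    rewrite -(pmulr_rge0 _ z0); apply: le_trans (grow z z0).
    rewrite subr_ge0 ler_sqr ?nnegrE ?w_ge0 ?ltW//.
    by rewrite (le_lt_trans _ hw)// (le_trans zy).
  - by move=> z /andP[x1z _]; apply: wdw; exact: lt_le_trans x1z.
have : 3 / 4 * (ln h - ln x1) <= (w x1)^-1.
  apply: (@quadratic_growth_bound _ w dw) => //.
  - by move=> z /andP[x1z _]; apply: wdw; exact: lt_le_trans x1z.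
  - by move=> z /we; exact: lt_le_trans.
  - move=> z /[dup] /we ez /andP[x1z zh]; have z0 := lt_le_trans x1_gt0 x1z.
    apply: le_trans (grow z z0).
    have : 2 * z <= w z by rewrite (le_trans _ ez)// mulrC -ler_pdivlMr.
    move=> zw; have : (2 * z) ^+ 2 <= w z ^+ 2.
      by rewrite ler_sqr// ?nnegrE ?w_ge0 ?mulr_ge0 ?ltW.
    by rewrite exprMn; lra.
have : (w x1)^-1 <= e^-1 by rewrite lef_pV2 ?posrE// (lt_le_trans e0).
have : ln x1 <= ln h - 2 / e.
  rewrite -[2 / e]expRK -ln_div ?posrE ?expR_gt0// -expRN.
  by rewrite ler_ln ?posrE ?mulr_gt0 ?expR_gt0// ltW.
have : 0 < e^-1 by rewrite invr_gt0.
lra.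
Unshelve. all: by end_near. Qed.

End riccati.

(** * The ratio and its Riccati equation *)

Section xratio.
Variable R : realType.
Implicit Types nu x : R.

Definition xratio nu x : R := x * K_ratio nu x.

Lemma xratio_gt0 nu x : 0 < x -> 0 < xratio nu x.
Proof. by move=> x0; rewrite mulr_gt0// divr_gt0// besselK_gt0. Qed.

Lemma xratio_recurrence nu x : 0 < x ->
  xratio nu x = 2 * nu + x ^+ 2 / xratio (nu - 1) x.
Proof.
move=> x0; have := besselK_recurrence nu x0.
have Kn := besselK_gt0 nu x0; have Km := besselK_gt0 (nu - 1) x0.
rewrite /xratio /K_ratio subrK; move: Kn Km.
move: (besselK nu x) (besselK (nu + 1) x) (besselK (nu - 1) x).
move=> K0 K1 Km K0_gt0 Km_gt0 rec.
have -> : K1 = (x * Km + 2 * nu * K0) / x.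
  by rewrite -rec; field; rewrite gt_eqF.
by field; rewrite !gt_eqF.
Qed.

Lemma xratio_gt nu x : 0 < x -> 2 * nu < xratio nu x.
Proof.
move=> x0; rewrite xratio_recurrence// ltrDl divr_gt0 ?exprn_gt0//.
exact: xratio_gt0.
Qed.

Lemma xratio_riccati nu x : 0 < x ->
  is_derive x 1 (xratio nu)
    ((xratio nu x ^+ 2 - 2 * nu * xratio nu x - x ^+ 2) / x).
Proof.
move=> x0; have Kn := besselK_gt0 nu x0.
have d0 := is_derive_besselK nu x0.
have d1 := is_derive_besselK (nu + 1) x0.
have dV := is_deriveV (lt0r_neq0 Kn) d0.
rewrite /xratio /K_ratio; apply: is_derive_eq; rewrite /GRing.scale/= addrK.
have rec0 := besselK_recurrence nu x0.
have rec1 := besselK_recurrence (nu + 1) x0; rewrite addrK in rec1.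
move: Kn rec0 rec1.
move: (besselK nu x) (besselK (nu + 1) x) (besselK (nu + 1 + 1) x)
  (besselK (nu - 1) x) => K0 K1 K2 Km Kn rec0 rec1.
have -> : K2 = (2 * (nu + 1) * K1 + x * K0) / x.
  by rewrite -rec1; field; rewrite gt_eqF.
have -> : Km = (x * K1 - 2 * nu * K0) / x.
  by rewrite -rec0; field; rewrite gt_eqF.
by field; rewrite !gt_eqF.
Qed.

Lemma xratio_cvg0 nu : 0 <= nu -> xratio nu x @[x --> 0^'+] --> 2 * nu.
Proof.
move=> nu0; apply: (@riccati_cvg0 _ nu (xratio nu)) => // x x0.
  exact: xratio_riccati.
by rewrite ltW// xratio_gt.
Qed.

End xratio.

(** * Bounds of the ratio by the functions b *)

Local Notation radical beta gamma x :=
  (Num.sqrt (beta ^+ 2 + gamma ^+ 2 * x ^+ 2)).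

Section branch.
Variable R : realType.
Implicit Types alpha beta gamma nu x a : R.

Definition branch alpha beta gamma x : R :=
  alpha + radical beta gamma x.

Lemma sqr_radical beta gamma x :
  radical beta gamma x ^+ 2 = beta ^+ 2 + gamma ^+ 2 * x ^+ 2.
Proof. by rewrite sqr_sqrtr// addr_ge0 ?sqr_ge0// mulr_ge0 ?sqr_ge0. Qed.

Lemma radical_gt0 beta gamma x : 0 < gamma -> 0 < x -> 0 < radical beta gamma x.
Proof.
by move=> g0 x0; rewrite sqrtr_gt0 ltr_wpDl ?sqr_ge0// mulr_gt0// exprn_gt0.
Qed.

Lemma radical_ge_beta beta gamma x : 0 <= beta -> beta <= radical beta gamma x.
Proof.
move=> b0; rewrite -{1}(ger0_norm b0) -sqrtr_sqr ler_wsqrtr// lerDl.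
by rewrite mulr_ge0 ?sqr_ge0.
Qed.

Lemma radical_ge_gammax beta gamma x : 0 <= gamma -> 0 <= x ->
  gamma * x <= radical beta gamma x.
Proof.
move=> g0 x0; rewrite -{1}(ger0_norm (mulr_ge0 g0 x0)) -sqrtr_sqr ler_wsqrtr//.
by rewrite exprMn lerDr sqr_ge0.
Qed.

Lemma radical_le beta gamma x : 0 <= beta -> 0 <= gamma -> 0 <= x ->
  radical beta gamma x <= beta + gamma * x.
Proof.
move=> b0 g0 x0.
rewrite -(@ler_pXn2r _ 2)// ?nnegrE ?sqrtr_ge0 ?addr_ge0 ?mulr_ge0//.
by rewrite sqr_radical sqrrD exprMn lerD2r lerDl mulrn_wge0// !mulr_ge0.
Qed.

Lemma is_derive_branch alpha beta gamma x : 0 < gamma -> 0 < x ->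
  is_derive x 1 (branch alpha beta gamma)
    (gamma ^+ 2 * x / radical beta gamma x).
Proof.
move=> g0 x0; have s0 := radical_gt0 beta g0 x0.
have r0 : 0 < beta ^+ 2 + gamma ^+ 2 * x ^+ 2 by rewrite -sqrtr_gt0.
have ds := is_derive1_sqrt r0.
have dr : is_derive x 1 (fun y => beta ^+ 2 + gamma ^+ 2 * y ^+ 2)
    (2 * gamma ^+ 2 * x).
  by apply: is_derive_eq; rewrite /GRing.scale/=; ring.
have dc := @is_derive1_comp _ _
  (fun y => beta ^+ 2 + gamma ^+ 2 * y ^+ 2) _ _ _ ds dr.
have -> : gamma ^+ 2 * x / radical beta gamma x =
    0 + (2 * radical beta gamma x)^-1 * (2 * gamma ^+ 2 * x).
  by field; rewrite gt_eqF.
exact: is_deriveD.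
Qed.

(** Expressed in the radical s alone, x^2 being (s^2 - beta^2) / gamma^2; the
sign of the residual then reduces to that of a polynomial in s. *)
Lemma residual_branch nu alpha beta gamma x : 0 < gamma -> 0 < x ->
  let s := radical beta gamma x in
  riccati_residual nu (branch alpha beta gamma)
    (fun x => gamma ^+ 2 * x / radical beta gamma x) x =
  alpha ^+ 2 - 2 * nu * alpha + beta ^+ 2 + (2 * (alpha - nu) - 1) * s +
  (s ^+ 2 - beta ^+ 2) * (1 - gamma ^- 2) + beta ^+ 2 / s.
Proof.
move=> g0 x0 s; have s0 : 0 < s := radical_gt0 beta g0 x0.
have s2 : s ^+ 2 = beta ^+ 2 + gamma ^+ 2 * x ^+ 2 := sqr_radical beta gamma x.
rewrite /riccati_residual /branch -/s.
have xE : x ^+ 2 = (s ^+ 2 - beta ^+ 2) / gamma ^+ 2.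
  by rewrite s2; field; rewrite gt_eqF.
have -> : x * (gamma ^+ 2 * x / s) = gamma ^+ 2 * x ^+ 2 / s.
  by field; rewrite gt_eqF.
by rewrite xE; field; rewrite !gt_eqF.
Qed.

Lemma xratio_le_branch nu alpha beta gamma a :
  0 < a -> 0 < gamma -> nu <= alpha ->
  (forall x, a <= x -> 0 <= riccati_residual nu (branch alpha beta gamma)
    (fun x => gamma ^+ 2 * x / radical beta gamma x) x) ->
  forall x, a <= x -> xratio nu x <= branch alpha beta gamma x.
Proof.
move=> a0 g0 nua; apply: (@riccati_supersolution _ nu (xratio nu)) => //.
- by move=> x x0; exact: xratio_riccati.
- by move=> x ax; apply: is_derive_branch => //; exact: lt_le_trans ax.
- by move=> x ax; rewrite /branch (le_trans nua)// lerDl sqrtr_ge0.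
Qed.

Lemma branch_le_xratio nu alpha beta gamma a : 0 <= nu -> 0 <= beta -> 0 < a ->
  0 < gamma -> 2 <= alpha ->
  (forall x, a <= x -> riccati_residual nu (branch alpha beta gamma)
    (fun x => gamma ^+ 2 * x / radical beta gamma x) x <= 0) ->
  forall x, a <= x -> branch alpha beta gamma x <= xratio nu x.
Proof.
move=> nu0 b0 a0 g0 al2.
apply: (@riccati_subsolution _ nu (xratio nu) _ _ _ _ _
  ((alpha + beta) / a + gamma)) => //.
- by move=> x x0; exact: xratio_riccati.
- by move=> x x0; rewrite ltW// xratio_gt.
- by move=> x ax; apply: is_derive_branch => //; exact: lt_le_trans ax.
- move=> x ax; have x0 := lt_le_trans a0 ax; rewrite /branch.
  rewrite (le_trans al2) ?lerDl ?sqrtr_ge0//=.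
  rewrite mulrDl.
  have := radical_le b0 (ltW g0) (ltW x0).
  have : alpha + beta <= (alpha + beta) / a * x.
    by rewrite mulrAC ler_pdivlMr// ler_wpM2l//; lra.
  lra.
Qed.

(** For alpha = nu + 1/2 and gamma = 1 the terms of the residual that are linear
in s cancel, leaving beta^2 - (nu^2 - 1/4) + beta^2 / s. *)
Lemma xratio_le_branch_half nu beta : nu ^+ 2 - 1 / 4 <= beta ^+ 2 ->
  forall x, 0 < x -> xratio nu x <= branch (nu + 1 / 2) beta 1 x.
Proof.
move=> hb x0 x0_gt0.
apply: (xratio_le_branch x0_gt0 ltr01 _ _ (lexx _)); first by lra.
move=> x xx0; have x_gt0 := lt_le_trans x0_gt0 xx0.
rewrite residual_branch//=; set s := radical _ _ _.
have : 0 <= beta ^+ 2 / s by rewrite divr_ge0 ?sqr_ge0 ?sqrtr_ge0.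
rewrite expr1n invr1 subrr mulr0 addr0 => h; nra.
Qed.

(** Since s >= x, the condition on beta holds for all large x as soon as
beta^2 < nu^2 - 1/4; the bound is then only valid on a half-line [a, +oo). *)
Lemma branch_half_le_xratio nu beta a : 3 / 2 <= nu -> 0 <= beta -> 0 < a ->
  (forall x, a <= x ->
     beta ^+ 2 / radical beta 1 x <= nu ^+ 2 - 1 / 4 - beta ^+ 2) ->
  forall x, a <= x -> branch (nu + 1 / 2) beta 1 x <= xratio nu x.
Proof.
move=> nu32 b0 a0 hb; apply: branch_le_xratio => //; [lra|lra|].
move=> x ax; have x_gt0 := lt_le_trans a0 ax.
rewrite residual_branch//=; have := hb x ax; set s := radical _ _ _.
rewrite expr1n invr1 subrr mulr0 addr0 => h; nra.
Qed.

Lemma branch12_le_xratio nu : 3 / 2 <= nu ->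
  forall x, 0 < x -> branch (nu + 1 / 2) (nu - 1 / 2) 1 x <= xratio nu x.
Proof.
move=> nu32 x0 x0_gt0.
have b0 : 0 < nu - 1 / 2 by lra.
apply: (branch_half_le_xratio nu32 (ltW b0) x0_gt0 _ (lexx _)) => x xx0.
have x_gt0 := lt_le_trans x0_gt0 xx0.
have s0 := radical_gt0 (nu - 1 / 2) ltr01 x_gt0.
have sb := radical_ge_beta 1 x (ltW b0).
rewrite ler_pdivrMr//; nra.
Qed.

(** The residual is (s - beta)^2 / s with beta = nu - 1. *)
Lemma xratio_le_branch21 nu :
  forall x, 0 < x -> xratio nu x <= branch (nu + 1) (nu - 1) 1 x.
Proof.
move=> x0 x0_gt0.
apply: (xratio_le_branch x0_gt0 ltr01 _ _ (lexx _)); first by lra.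
move=> x xx0; have x_gt0 := lt_le_trans x0_gt0 xx0.
rewrite residual_branch//=; have s0 := radical_gt0 (nu - 1) ltr01 x_gt0.
set s := radical _ _ _ in s0 *.
rewrite [leRHS](_ : _ = (s - (nu - 1)) ^+ 2 / s).
  by rewrite divr_ge0 ?sqr_ge0// ltW.
by field; rewrite gt_eqF.
Qed.

(** The residual is - (s - beta)^3 / (beta s) with beta = nu - 2. *)
Lemma branch30_le_xratio nu gamma : 2 < nu -> 0 < gamma ->
  gamma ^+ 2 = (nu - 2) / (nu - 1) ->
  forall x, 0 < x -> branch (nu + 2) (nu - 2) gamma x <= xratio nu x.
Proof.
move=> nu2 g0 g2 x0 x0_gt0.
apply: (branch_le_xratio _ _ x0_gt0 g0 _ _ (lexx _)); [lra|lra|lra|].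
move=> x xx0; have x_gt0 := lt_le_trans x0_gt0 xx0.
rewrite residual_branch//=; have s0 := radical_gt0 (nu - 2) g0 x_gt0.
have b0 : 0 < nu - 2 by lra.
have sb := radical_ge_beta gamma x (ltW b0).
set s := radical _ _ _ in s0 sb *.
rewrite g2 [leLHS](_ : _ = - ((s - (nu - 2)) ^+ 3 / (s * (nu - 2)))).
  by rewrite oppr_le0 divr_ge0 ?exprn_ge0 ?subr_ge0// ltW// mulr_gt0.
by field; rewrite !gt_eqF//; lra.
Qed.

End branch.

(** * Coefficients determined by the expansions *)

Section gaps.
Variable R : realType.
Implicit Types alpha beta gamma nu x : R.

Lemma cvg_near_eq (F : set_system R) (f g : R -> R) (l l' : R) : Filter F ->
  l = l' -> (\forall x \near F, f x = g x) ->
  f x @[x --> F] --> l -> g x @[x --> F] --> l'.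
Proof. by move=> FF -> /near_eq_cvg fg; apply: cvg_trans. Qed.

Lemma littleo_div_cvg0 (F : filter_on R) (f e : R -> R) :
  (f : R -> R^o) =o_F (e : R -> R^o) -> (\forall x \near F, e x != 0) ->
  f x / e x @[x --> F] --> 0.
Proof.
move=> /eqoP fe e0; apply/cvgr0Pnorm_le => eps eps0.
have := fe eps eps0; apply: filterS2 e0 => x e0 h.
by rewrite normrM normfV ler_pdivrMr ?normr_gt0.
Qed.

Lemma invr_cvgy : x^-1 @[x --> +oo] --> (0 : R).
Proof.
by apply/gtr0_cvgV0; [exact: nbhs_pinfty_gt|exact: cvg_id].
Qed.

Lemma id_cvg0 : x @[x --> (0 : R)^'+] --> (0 : R).
Proof. by apply: cvg_at_right_filter; exact: cvg_id. Qed.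

Lemma cvg_exprn (F : set_system R) (f : R -> R) (l : R) n : Filter F ->
  f x @[x --> F] --> l -> f x ^+ n @[x --> F] --> l ^+ n.
Proof.
move=> FF fl; elim: n => [|n IHn]; first by rewrite expr0; exact: cvg_cst.
rewrite exprS; under eq_fun do rewrite exprS; exact: cvgM.
Qed.

(** Multiplying the o-condition by positive powers of x gives the gap at every
lower order, so that a coincidence of n terms contains those of fewer terms. *)
Lemma coincide_at_0_gap n k alpha beta gamma nu : (k < n)%N ->
  coincide_at_0 n (Bfun alpha beta gamma) (K_ratio nu) ->
  (branch alpha beta gamma x - xratio nu x) / x ^+ (2 * k) @[x --> 0^'+] --> 0.
Proof.
case: n => // n; rewrite ltnS => kn /(_ isT) /littleo_div_cvg0 h.
have /h {}h : \forall x \near (0 : R)^'+, x ^ (2 * n.+1%:Z - 3) != 0 :> R.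
  near=> x; rewrite expfz_neq0// gt_eqF//; near: x; exact: nbhs_right_gt.
have {}h : (Bfun alpha beta gamma x - K_ratio nu x) / x ^ (2 * n.+1%:Z - 3)
  @[x --> (0 : R)^'+] --> 0 := h.
have d : x ^+ (2 * (n - k)) @[x --> (0 : R)^'+] --> (0 : R) ^+ (2 * (n - k)).
  exact: cvg_exprn id_cvg0.
apply: cvg_near_eq (cvgM h d); first exact: mul0r.
near=> x; have x0 : 0 < x by near: x; exact: nbhs_right_gt.
have -> : x ^ (2 * n.+1%:Z - 3) = x ^+ (2 * k) * x ^+ (2 * (n - k)) / x.
  rewrite -exprD -mulnDr subnKC// exprnP -[x^-1]exprN1 -expfzDr ?gt_eqF//.
  by congr (_ ^ _); lia.
rewrite /= /Bfun /xratio -/(branch _ _ _ x).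
move: (K_ratio nu x) (branch alpha beta gamma x) => K b.
by field; rewrite !gt_eqF// exprn_gt0.
Unshelve. all: by end_near. Qed.

Lemma coincide_at_infty_gap m k alpha beta gamma nu : (k < m)%N ->
  coincide_at_infty m (Bfun alpha beta gamma) (K_ratio nu) ->
  (branch alpha beta gamma x - xratio nu x) * x ^+ k / x @[x --> +oo] --> 0.
Proof.
case: m => // m; rewrite ltnS => km /(_ isT) /littleo_div_cvg0 h.
have /h {}h : \forall x \near +oo, x ^ (- (m.+1%:Z - 1)) != 0 :> R.
  near=> x; rewrite expfz_neq0// gt_eqF//; near: x; exact: nbhs_pinfty_gt.
have d : (x^-1) ^+ (m - k) @[x --> +oo] --> (0 : R) ^+ (m - k).
  exact: cvg_exprn invr_cvgy.
apply: cvg_near_eq (cvgM h d); first exact: mul0r.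
near=> x; have x0 : 0 < x by near: x; exact: nbhs_pinfty_gt.
rewrite /= intS addrAC subrr add0r -exprnN invrK.
rewrite /Bfun /xratio -/(branch _ _ _ x).
rewrite -(subnK km) addnK exprD exprVn; field.
by rewrite !gt_eqF// exprn_gt0.
Unshelve. all: by end_near. Qed.

Lemma radical_cvg0 beta gamma : 0 <= beta ->
  radical beta gamma x @[x --> 0^'+] --> beta.
Proof.
move=> b0; rewrite -[X in _ --> X]ger0_norm// -sqrtr_sqr.
apply: (@cvg_comp _ _ _ (fun x => beta ^+ 2 + gamma ^+ 2 * x ^+ 2)); last first.
  exact: sqrt_continuous.
have h : beta ^+ 2 + gamma ^+ 2 * x ^+ 2 @[x --> 0^'+] -->
    beta ^+ 2 + gamma ^+ 2 * 0 ^+ 2.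
  apply: cvgD; first exact: cvg_cst.
  by apply: cvgM; [exact: cvg_cst|exact: cvg_exprn id_cvg0].
by move: h; rewrite expr0n mulr0 addr0.
Qed.

Lemma coincide_at_0_first n alpha beta gamma nu :
  0 <= nu -> 0 <= beta -> (0 < n)%N ->
  coincide_at_0 n (Bfun alpha beta gamma) (K_ratio nu) -> alpha + beta = 2 * nu.
Proof.
move=> nu0 b0 n0 /(coincide_at_0_gap n0) gap.
have h : branch alpha beta gamma x @[x --> 0^'+] --> 2 * nu.
  apply: cvg_near_eq (cvgD gap (xratio_cvg0 nu0)); first exact: add0r.
  by near=> x; rewrite /= muln0 expr0 divr1 subrK.
have h' : branch alpha beta gamma x @[x --> 0^'+] --> alpha + beta.
  by apply: cvgD; [exact: cvg_cst|exact: radical_cvg0].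
exact: cvg_unique h' h.
Unshelve. all: by end_near. Qed.

(** By the recurrence (phi_nu - 2 nu) / x^2 is 1 / phi_(nu-1), which tends to
1 / (2 (nu - 1)). *)
Lemma radical_quotient_cvg0 n alpha beta gamma nu :
  2 <= nu -> 0 <= beta -> (1 < n)%N ->
  coincide_at_0 n (Bfun alpha beta gamma) (K_ratio nu) ->
  (radical beta gamma x - beta) / x ^+ 2 @[x --> 0^'+] --> (2 * (nu - 1))^-1.
Proof.
move=> nu2 b0 n1 c0.
have nu0 : 0 <= nu by lra.
have nu10 : 0 <= nu - 1 by lra.
have ab := coincide_at_0_first nu0 b0 (ltnW n1) c0.
have gap := coincide_at_0_gap n1 c0.
have l0 : 2 * (nu - 1) != 0 by rewrite gt_eqF//; lra.
have z : ((xratio (nu - 1) x)^-1) @[x --> 0^'+] --> (2 * (nu - 1))^-1.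
  exact: cvgV l0 (xratio_cvg0 nu10).
apply: cvg_near_eq (cvgD gap z); first exact: add0r.
near=> x; have x0 : 0 < x by near: x; exact: nbhs_right_gt.
have p0 := xratio_gt0 (nu - 1) x0.
rewrite /= muln1 (xratio_recurrence nu x0) /branch -ab.
move: (xratio _ x) (radical _ _ _) p0 => p s p0.
by field; rewrite !gt_eqF.
Unshelve. all: by end_near. Qed.

(** The value of gamma^2 is the limit of the product of (s - beta) / x^2 and
s + beta. If beta were 0 then gamma and s would vanish too, against the nonzero
limit of (s - beta) / x^2. *)
Lemma coincide_at_0_second n alpha beta gamma nu :
  2 <= nu -> 0 <= beta -> (1 < n)%N ->
  coincide_at_0 n (Bfun alpha beta gamma) (K_ratio nu) ->
  0 < beta /\ gamma ^+ 2 = beta / (nu - 1).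
Proof.
move=> nu2 b0 n1 c0; have q := radical_quotient_cvg0 nu2 b0 n1 c0.
have g2 : gamma ^+ 2 = beta / (nu - 1).
  have h : gamma ^+ 2 @[x --> (0 : R)^'+] --> (2 * (nu - 1))^-1 * (beta + beta).
    have rb : radical beta gamma x + beta @[x --> 0^'+] --> beta + beta.
      by apply: cvgD; [exact: radical_cvg0|exact: cvg_cst].
    apply: cvg_near_eq (cvgM q rb) => //; near=> x.
    have x0 : 0 < x by near: x; exact: nbhs_right_gt.
    rewrite /= mulrAC -subr_sqr sqr_radical addrAC subrr add0r mulfK//.
    by rewrite expf_eq0/= gt_eqF.
  rewrite (cvg_unique _ (cvg_cst (gamma ^+ 2)) h)//; field; lra.
split => //; rewrite lt_neqAle b0 andbT eq_sym; apply/eqP => b00.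
have h : (0 : R) @[x --> (0 : R)^'+] --> (2 * (nu - 1))^-1.
  apply: cvg_near_eq q => //; near=> x.
  by rewrite g2 b00 expr0n/= mul0r mul0r addr0 sqrtr0 subrr mul0r.
have e : (2 * (nu - 1))^-1 = 0.
  by rewrite (cvg_unique _ h (cvg_cst 0)).
by move/eqP: e; rewrite invr_eq0 => /eqP; lra.
Unshelve. all: by end_near. Qed.

(** With c = 1 / (2 (nu - 1)), the recurrence gives
(1 / phi_(nu-1) - c) / x^2 = - c / (phi_(nu-1) phi_(nu-2)), whereas the radical
gives ((s - beta) / x^2 - c) / x^2 -> - c^2 / (2 beta). Multiplying by
phi_(nu-1) phi_(nu-2), whose limit is (nu - 2) times a nonzero constant, keeps
the argument uniform down to nu = 2. *)
Lemma coincide_at_0_third n alpha beta gamma nu :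
  2 <= nu -> 0 <= beta -> (2 < n)%N ->
  coincide_at_0 n (Bfun alpha beta gamma) (K_ratio nu) -> beta = nu - 2.
Proof.
move=> nu2 b0 n2 c0.
have nu0 : 0 <= nu by lra.
have nu10 : 0 <= nu - 1 by lra.
have nu20 : 0 <= nu - 1 - 1 by lra.
have ab := coincide_at_0_first nu0 b0 (ltnW (ltnW n2)) c0.
have q := radical_quotient_cvg0 nu2 b0 (ltnW n2) c0.
have [b_gt0 g2] := coincide_at_0_second nu2 b0 (ltnW n2) c0.
have gap := coincide_at_0_gap n2 c0.
have p1 := xratio_cvg0 nu10; have p2 := xratio_cvg0 nu20.
pose c := (2 * (nu - 1))^-1.
have bb0 : beta + beta != 0 by rewrite gt_eqF// addr_gt0.
have rV : (radical beta gamma x + beta)^-1 @[x --> 0^'+] --> (beta + beta)^-1.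
  by apply: (cvgV bb0); apply: cvgD; [exact: radical_cvg0|exact: cvg_cst].
have L : (- c * ((radical beta gamma x - beta) / x ^+ 2) *
   (radical beta gamma x + beta)^-1 -
   (branch alpha beta gamma x - xratio nu x) / x ^+ (2 * 2)) *
   (xratio (nu - 1) x * xratio (nu - 1 - 1) x) @[x --> 0^'+] -->
   (- c * c * (beta + beta)^-1 - 0) * (2 * (nu - 1) * (2 * (nu - 1 - 1))).
  by apply: cvgM; [apply: cvgB => //; apply: cvgM => //; apply: cvgM => //;
    exact: cvg_cst | exact: cvgM].
have E : - c @[x --> (0 : R)^'+] -->
   (- c * c * (beta + beta)^-1 - 0) * (2 * (nu - 1) * (2 * (nu - 1 - 1))).
  apply: cvg_near_eq L => //; near=> x.
  have x0 : 0 < x by near: x; exact: nbhs_right_gt.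
  have P1 := xratio_gt0 (nu - 1) x0.
  have P2 := xratio_gt0 (nu - 1 - 1) x0.
  have s2 := sqr_radical beta gamma x.
  have s0 : 0 <= radical beta gamma x := sqrtr_ge0 _.
  rewrite (xratio_recurrence nu x0) /branch -ab.
  have rec := xratio_recurrence (nu - 1) x0.
  move: P1 P2 rec s2 s0.
  move: (xratio (nu - 1) x) (xratio (nu - 1 - 1) x) (radical beta gamma x).
  move=> P1 P2 s P1_gt0 P2_gt0 rec s2 s0.
  have T0 : s + beta != 0 by rewrite gt_eqF// ltr_wpDl.
  have x20 : x ^+ 2 != 0 by rewrite expf_eq0/= gt_eqF.
  have c0' : c * (2 * (nu - 1)) = 1 by rewrite /c mulVf// gt_eqF//; lra.
  pose f := (s - beta) / x ^+ 2.
  have fT : f * (s + beta) = 2 * beta * c.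
    rewrite /f mulrAC -subr_sqr s2 addrAC subrr add0r mulfK// g2 /c.
    by field; lra.
  (* The common term f / x^2 of t1 and t2 cancels in their difference. *)
  have t1 : - c * f * (s + beta)^-1 = (f - c) / x ^+ 2.
    apply/eqP; rewrite eqr_div//; apply/eqP.
    transitivity (- c * (s - beta)); first by rewrite /f; field; rewrite gt_eqF.
    by rewrite mulrBl fT; ring.
  have t2 : (alpha + s - (alpha + beta + x ^+ 2 / P1)) / x ^+ (2 * 2) =
      (f - P1^-1) / x ^+ 2.
    by rewrite /f; field; rewrite !gt_eqF.
  rewrite t1 t2.
  transitivity ((1 - c * P1) * P2 / x ^+ 2).
    by field; rewrite !gt_eqF.
  by rewrite rec mulrDr c0'; field; rewrite !gt_eqF.
have e : - c =
   (- c * c * (beta + beta)^-1 - 0) * (2 * (nu - 1) * (2 * (nu - 1 - 1))).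
  by rewrite -(cvg_unique _ (cvg_cst (- c)) E).
move: e; rewrite (_ : _ * _ = - c * ((nu - 2) / beta)); last first.
  by rewrite /c; field; rewrite !gt_eqF//; lra.
rewrite -{1}[- c]mulr1 => /mulfI; rewrite oppr_eq0 invr_eq0 gt_eqF; last by lra.
move=> /(_ isT) e; have := congr1 (fun z => z * beta) e.
by rewrite /= mul1r divfK// gt_eqF.
Unshelve. all: by end_near. Qed.

Lemma radical1_subx_le beta x : 0 < x ->
  0 <= radical beta 1 x - x <= beta ^+ 2 / x.
Proof.
move=> x0; have s2 := sqr_radical beta 1 x.
have sx : x <= radical beta 1 x.
  by have := radical_ge_gammax beta ler01 (ltW x0); rewrite mul1r.
rewrite subr_ge0 sx/= ler_pdivlMr//; move: s2 sx.
by rewrite expr1n mul1r; move: (Num.sqrt _) => s s2 sx; nra.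
Qed.

Lemma radical1_subx_cvg beta : radical beta 1 x - x @[x --> +oo] --> 0.
Proof.
have h : beta ^+ 2 / x @[x --> +oo] --> 0.
  by apply: cvg_near_eq (cvgM (cvg_cst (beta ^+ 2)) invr_cvgy) => //;
    rewrite ?mulr0//; exact: nearW.
apply: squeeze_cvgr h; last exact: cvg_cst.
by near=> x; apply: radical1_subx_le; near: x; exact: nbhs_pinfty_gt.
Unshelve. all: by end_near. Qed.

(** The bounds (1,2) and (0,3) both differ from x + nu + 1/2 by O(1 / x). *)
Lemma xratio_subx_cvg nu : 3 / 2 <= nu ->
  xratio nu x - x @[x --> +oo] --> nu + 1 / 2.
Proof.
move=> nu32.
pose b0 := Num.sqrt (nu ^+ 2 - 1 / 4).
have b02 : b0 ^+ 2 = nu ^+ 2 - 1 / 4 by rewrite sqr_sqrtr//; nra.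
have lim b : branch (nu + 1 / 2) b 1 x - x @[x --> +oo] --> nu + 1 / 2.
  apply: cvg_near_eq (cvgD (cvg_cst (nu + 1 / 2)) (radical1_subx_cvg b)).
    exact: addr0.
  by apply: nearW => x; rewrite /= /branch addrA.
apply: squeeze_cvgr (lim (nu - 1 / 2)) (lim b0).
near=> x; have x0 : 0 < x by near: x; exact: nbhs_pinfty_gt.
rewrite !lerD2r branch12_le_xratio//= xratio_le_branch_half//.
by rewrite b02.
Unshelve. all: by end_near. Qed.

Lemma radical_divx_cvg beta gamma : 0 <= beta -> 0 <= gamma ->
  radical beta gamma x / x @[x --> +oo] --> gamma.
Proof.
move=> b0 g0.
have h : gamma + beta / x @[x --> +oo] --> gamma.
  apply: cvg_near_eq (cvgD (cvg_cst gamma) (cvgM (cvg_cst beta) invr_cvgy)).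
    by rewrite mulr0 addr0.
  exact: nearW.
apply: squeeze_cvgr h; last exact: cvg_cst.
near=> x; have x0 : 0 < x by near: x; exact: nbhs_pinfty_gt.
rewrite ler_pdivlMr// radical_ge_gammax ?(ltW x0)//= ler_pdivrMr//.
by rewrite mulrDl divfK ?gt_eqF// [leRHS]addrC radical_le// ltW.
Unshelve. all: by end_near. Qed.

Lemma coincide_at_infty_first m alpha beta gamma nu :
  3 / 2 <= nu -> 0 <= beta -> 0 <= gamma -> (0 < m)%N ->
  coincide_at_infty m (Bfun alpha beta gamma) (K_ratio nu) -> gamma = 1.
Proof.
move=> nu32 b0 g0 m0 /(coincide_at_infty_gap m0) gap.
have phi : (xratio nu x - x) / x @[x --> +oo] --> 0.
  apply: cvg_near_eq (cvgM (xratio_subx_cvg nu32) invr_cvgy).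
    exact: mulr0.
  exact: nearW.
have al : alpha / x @[x --> +oo] --> 0.
  apply: cvg_near_eq (cvgM (cvg_cst alpha) invr_cvgy); first exact: mulr0.
  exact: nearW.
have h : radical beta gamma x / x @[x --> +oo] --> (1 : R).
  apply: cvg_near_eq (cvgD (cvgB (cvgD gap phi) al) (cvg_cst (1 : R))).
    by rewrite addr0 subr0 add0r.
  near=> x; have x0 : 0 < x by near: x; exact: nbhs_pinfty_gt.
  rewrite !fctE/= expr0 mulr1 /branch.
  move: (xratio nu x) (radical _ _ _) => p s.
  by field; rewrite gt_eqF.
exact: cvg_unique (radical_divx_cvg b0 g0) h.
Unshelve. all: by end_near. Qed.

Lemma coincide_at_infty_second m alpha beta nu :
  3 / 2 <= nu -> (1 < m)%N ->
  coincide_at_infty m (Bfun alpha beta 1) (K_ratio nu) -> alpha = nu + 1 / 2.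
Proof.
move=> nu32 m1 /(coincide_at_infty_gap m1) gap.
have h : alpha @[x --> +oo_R] --> nu + 1 / 2.
  apply: cvg_near_eq
    (cvgD gap (cvgB (xratio_subx_cvg nu32) (radical1_subx_cvg beta))).
    by rewrite subr0 add0r.
  near=> x; have x0 : 0 < x by near: x; exact: nbhs_pinfty_gt.
  rewrite !fctE/= expr1 /branch; move: (xratio nu x) (radical _ _ _) => p s.
  by field; rewrite gt_eqF.
exact: cvg_unique (cvg_cst alpha) h.
Unshelve. all: by end_near. Qed.

(** If beta^2 were smaller, choose b1^2 halfway between beta^2 and nu^2 - 1/4:
near infinity phi lies above the function with parameter b1, hence above the
given one by at least a constant multiple of 1 / x. *)
Lemma coincide_at_infty_third m beta nu :
  3 / 2 <= nu -> 0 <= beta -> (2 < m)%N ->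
  coincide_at_infty m (Bfun (nu + 1 / 2) beta 1) (K_ratio nu) ->
  nu ^+ 2 - 1 / 4 <= beta ^+ 2.
Proof.
move=> nu32 b0 m2 /(coincide_at_infty_gap m2) gap.
rewrite leNgt; apply/negP => bb.
pose d := (nu ^+ 2 - 1 / 4 - beta ^+ 2) / 2.
have d0 : 0 < d by rewrite /d; lra.
pose b1 := Num.sqrt (beta ^+ 2 + d).
have b12 : b1 ^+ 2 = beta ^+ 2 + d.
  by rewrite sqr_sqrtr// addr_ge0 ?sqr_ge0// ltW.
have b1_ge0 : 0 <= b1 := sqrtr_ge0 _.
have b1b : beta <= b1.
  by rewrite -(@ler_pXn2r _ 2) ?nnegrE// b12 lerDl ltW.
pose a := Num.max 1 (Num.max b1 (b1 ^+ 2 / d)).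
have a1 : 1 <= a by rewrite le_max lexx.
have ab1 : b1 <= a by rewrite !le_max lexx orbT.
have abd : b1 ^+ 2 / d <= a by rewrite !le_max lexx !orbT.
have low x : a <= x -> branch (nu + 1 / 2) b1 1 x <= xratio nu x.
  apply: branch_half_le_xratio => //; first exact: lt_le_trans a1.
  move=> y ay; have y0 : 0 < y by lra.
  have sy := radical_ge_gammax b1 ler01 (ltW y0); rewrite mul1r in sy.
  rewrite ler_pdivrMr; last exact: lt_le_trans sy.
  have -> : nu ^+ 2 - 1 / 4 - b1 ^+ 2 = d by rewrite b12 /d; lra.
  by rewrite mulrC -ler_pdivrMr//; lra.
suff : d / 4 <= 0 by lra.
suff : 0 <= - (d / 4) by lra.
apply: (cvgr_to_le gap); near=> x.
have ax : a <= x by near: x; apply: nbhs_pinfty_ge; exact: num_real.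
have x0 : 0 < x by lra.
have := low x ax; rewrite /branch; move: (xratio nu x) => p.
have s2 := sqr_radical beta 1 x; have t2 := sqr_radical b1 1 x.
have sb := radical_le b0 ler01 (ltW x0).
have tb := radical_le b1_ge0 ler01 (ltW x0).
have s0 : 0 <= radical beta 1 x := sqrtr_ge0 _.
have t0 : 0 <= radical b1 1 x := sqrtr_ge0 _.
have tx := radical_ge_gammax b1 ler01 (ltW x0).
move: s2 t2 sb tb s0 t0 tx; rewrite b12 !expr1n !mul1r.
move: (Num.sqrt _) (Num.sqrt _) => t s s2 t2 sb tb s0 t0 tx ptx.
have st : d <= (t - s) * (4 * x).
  have e : (t - s) * (t + s) = d by rewrite -subr_sqr t2 s2; ring.
  have ts : 0 <= t - s.
    have : 0 <= (t - s) * (t + s) by rewrite e ltW.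
    by rewrite pmulr_lge0// ltr_pwDl// (lt_le_trans x0).
  by rewrite -e ler_wpM2l//; lra.
have -> : (nu + 2^-1 + s - p) * x ^+ 2 / x = (nu + 2^-1 + s - p) * x.
  by field; rewrite gt_eqF.
have : (nu + 2^-1 + s - p) * x <= (s - t) * x by rewrite ler_pM2r//; lra.
lra.
Unshelve. all: by end_near. Qed.

End gaps.

(** * The theorem *)

Theorem theorem4 (R : realType) :
  exists2 nu0 : R, nu0 <= 2 &
  forall nu : R, nu0 <= nu ->
  forall (n m : nat),
    (n, m) \in [:: (3, 0); (2, 1); (1, 2); (0, 3)]%N ->
  forall alpha beta gamma : R, 0 <= beta -> 0 <= gamma ->
    coincide_at_0 n (Bfun alpha beta gamma) (K_ratio nu) ->
    coincide_at_infty m (Bfun alpha beta gamma) (K_ratio nu) ->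
    (forall x : R, 0 < x -> K_ratio nu x <= Bfun alpha beta gamma x) \/
    (forall x : R, 0 < x -> Bfun alpha beta gamma x <= K_ratio nu x).
Proof.
exists 2 => // nu nu2 n m nm alpha beta gamma b0 g0 c0 cy.
have nu0 : 0 <= nu by lra.
have nu32 : 3 / 2 <= nu by lra.
have BE x : Bfun alpha beta gamma x = branch alpha beta gamma x / x by [].
have KE x : 0 < x -> K_ratio nu x = xratio nu x / x.
  by move=> x0; rewrite /xratio mulrC mulKf// gt_eqF.
suff [h|h] :
    (forall x : R, 0 < x -> xratio nu x <= branch alpha beta gamma x) \/
    (forall x : R, 0 < x -> branch alpha beta gamma x <= xratio nu x).
- by left => x x0; rewrite BE KE// ler_pM2r ?invr_gt0// h.
- by right => x x0; rewrite BE KE// ler_pM2r ?invr_gt0// h.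
move: nm; rewrite !inE => /or4P[] /eqP[nE mE]; subst n m.
- right; have ab := coincide_at_0_first nu0 b0 (isT : (0 < 3)%N) c0.
  have [b_gt0 g2] := coincide_at_0_second nu2 b0 (isT : (1 < 3)%N) c0.
  have bE := coincide_at_0_third nu2 b0 (isT : (2 < 3)%N) c0.
  have aE : alpha = nu + 2 by lra.
  have g_gt0 : 0 < gamma.
    rewrite lt0r g0 andbT -sqrf_eq0 g2.
    by rewrite mulf_eq0 invr_eq0 negb_or !gt_eqF//; lra.
  by rewrite aE bE; apply: branch30_le_xratio => //; [lra|rewrite -bE].
- left; have ab := coincide_at_0_first nu0 b0 (isT : (0 < 2)%N) c0.
  have [b_gt0 g2] := coincide_at_0_second nu2 b0 (isT : (1 < 2)%N) c0.
  have gE := coincide_at_infty_first nu32 b0 g0 (isT : (0 < 1)%N) cy.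
  have bE : beta = nu - 1.
    move: g2; rewrite gE expr1n => /(congr1 (fun z => z * (nu - 1))).
    by rewrite mul1r divfK// gt_eqF//; lra.
  have aE : alpha = nu + 1 by lra.
  by rewrite aE bE gE; exact: xratio_le_branch21.
- right; have ab := coincide_at_0_first nu0 b0 (isT : (0 < 1)%N) c0.
  have gE := coincide_at_infty_first nu32 b0 g0 (isT : (0 < 2)%N) cy.
  subst gamma.
  have aE := coincide_at_infty_second nu32 (isT : (1 < 2)%N) cy.
  have bE : beta = nu - 1 / 2 by lra.
  by rewrite aE bE; exact: branch12_le_xratio.
- left; have gE := coincide_at_infty_first nu32 b0 g0 (isT : (0 < 3)%N) cy.
  subst gamma.
  have aE := coincide_at_infty_second nu32 (isT : (1 < 3)%N) cy; subst alpha.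
  apply: xratio_le_branch_half.
  exact: (coincide_at_infty_third nu32 b0 (isT : (2 < 3)%N) cy).
Qed.
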